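(* Let $b\ge a\ge 0$. There is a bijection $$\theta:\{\pi\in\mathcal I_{a+b}(321):\mathrm{fp}(\pi)\ge b-a\}\longrightarrow\mathcal Y_{a,b}$$ such that whenever $\theta(\pi)=\lambda$, one has $\mathrm{Des}(\pi)=\mathrm{hd}(\lambda)$.
   Context: $\mathcal I_m(321)$ is the set of involutions in $\mathcal S_m$ avoiding the pattern $321$. $\mathrm{fp}(\pi)$ is the number of fixed points of $\pi$. $\mathrm{Des}(\pi)$ is the set of positions $i$ with $\pi(i)>\pi(i+1)$. $\mathcal Y_{a,b}$ is the set of Young diagrams (partitions) fitting inside an $a\times b$ rectangle ($a$ rows, $b$ columns). For a diagram $\lambda$ with conjugate $\lambda'$ and Durfee square of side $d$ (largest $d$ with $\lambda_d\ge d$), the hook decomposition is $\mathrm{hd}(\lambda)=\{\lambda_i+\lambda'_i-2i+1:1\le i\le d\}$, the sizes of the hooks obtained by successively removing the first row and first column. *)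

(* Defs.v *)
From mathcomp Require Import all_boot all_order all_fingroup.
Set Implicit Arguments. Unset Strict Implicit. Unset Printing Implicit Defensive.

(* Permutations of {1..m} are modelled by 'S_m (permutations of 'I_m = {0..m-1});
   position/value k (1-based) corresponds to the ordinal k-1. *)

Definition is_involution m (p : 'S_m) : bool := [forall i, p (p i) == i].

Definition avoids321 m (p : 'S_m) : bool :=
  [forall i : 'I_m, forall j : 'I_m, forall k : 'I_m,
     ~~ [&& (i < j)%N, (j < k)%N, (p k < p j)%N & (p j < p i)%N]].

Definition inv321 m (p : 'S_m) : bool := is_involution p && avoids321 p.

Definition fp m (p : 'S_m) : nat := #|[set i | p i == i]|.

Definition Des m (p : 'S_m) : seq nat :=
  [seq (val i).+1 | i <- enum 'I_m &
     [exists j : 'I_m, (val j == (val i).+1) && (p j < p i)%N]].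

(* A Young diagram (partition) is a weakly decreasing list of positive row
   lengths lam = [:: lam_1; lam_2; ...]. It fits in an a x b rectangle
   (a rows, b columns) iff it has at most a rows, each of length at most b. *)
Definition is_young (a b : nat) (lam : seq nat) : bool :=
  [&& sorted geq lam, all (fun x => 0 < x) lam, size lam <= a
    & all (fun x => x <= b) lam].

(* lam_i, 1-based (0 beyond the last row) *)
Definition part (lam : seq nat) (i : nat) : nat := nth 0 lam i.-1.

Definition conjp (lam : seq nat) (i : nat) : nat := count (fun x => i <= x) lam.

Definition durfee (lam : seq nat) : nat :=
  \max_(i < (size lam).+1 | i <= part lam i) i.

Definition hd (lam : seq nat) : seq nat :=
  [seq (part lam i + conjp lam i + 1) - i.*2 | i <- iota 1 (durfee lam)].

(* Main.v *)
Require Import Defs.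
From mathcomp Require Import all_boot all_order all_fingroup.
From mathcomp Require Import zify.
Set Implicit Arguments. Unset Strict Implicit. Unset Printing Implicit Defensive.

(* In a 321-avoiding involution no 2-cycle is nested in another one and no fixed
   point lies under a 2-cycle. Writing U at the smaller and D at the larger element
   of each 2-cycle, such an involution is therefore a word in U, D and fixed points,
   the latter only at height 0, and its descents are the positions of the factors
   UD. If there are c 2-cycles then fp >= b - a means c <= a. Turn the first a - c
   fixed points into D and the others into U: the result is a word with a letters D
   and b letters U, every such word arises exactly once (the fixed points are the
   unmatched letters), and no factor UD is created or destroyed.
   Finally, words with a letters D and b letters U encode diagrams in the a x b box:
   if the last factor UD of w splits it as w = x U D D^s U^t, the outermost hook has
   one row more than x has letters D and as many columns as x U has letters U, and
   removing it leaves the diagram of x. That hook has size |x U|, the position of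
   the factor UD. *)

(** * Diagrams built hook by hook; the Durfee square *)

Lemma geq_transitive : transitive geq.
Proof. by move=> x y z /= yx zy; apply: leq_trans zy yx. Qed.

(** [a] counts the rows below the first; the default 0 of [nth] gives length one to those beyond the
    end of [mu]. *)
Definition add_hook (a b : nat) (mu : seq nat) : seq nat :=
  b :: mkseq (fun i => (nth 0 mu i).+1) a.

(* The word is read from its last letter; [true] is U, [false] is D. *)
Fixpoint young_of_word (r : seq bool) : seq nat :=
  match r with
  | [::] => [::]
  | true :: r1 => young_of_word r1
  | false :: ((true :: r2) as r1) =>
      add_hook (count negb r2) (count id r2).+1 (young_of_word r2)
  | false :: r1 => young_of_word r1
  end.

Lemma durfee_part lam : durfee lam <= part lam (durfee lam).
Proof.
rewrite /durfee.
have [i iP ->] : exists2 i : 'I_(size lam).+1, i <= part lam i &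
    \max_(i < (size lam).+1 | i <= part lam i) i = i.
  have := @eq_bigmax_cond _ [pred i : 'I_(size lam).+1 | i <= part lam i] (@nat_of_ord _).
  by case=> [|i]; [apply/card_gt0P; exists ord0 | exists i].
exact: iP.
Qed.

Lemma durfee_size lam : durfee lam <= size lam.
Proof. by apply/bigmax_leqP => i _; rewrite -ltnS. Qed.

Lemma durfee_max lam k : k <= part lam k -> k <= durfee lam.
Proof.
have [lt_k le_k|ge_k] := ltnP k (size lam).+1.
  exact: (@leq_bigmax_cond _ (fun i : 'I_ _ => i <= part lam i) (@nat_of_ord _) (Ordinal lt_k)).
by rewrite /part nth_default; lia.
Qed.

(** * Effect of a new outermost hook *)

Section AddHook.
Variables (a b : nat) (mu : seq nat).
Hypothesis yng : is_young a b mu.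

Let mu_size : size mu <= a. Proof. by case/and4P: yng. Qed.
Let mu_le i : nth 0 mu i <= b.
Proof.
case/and4P: yng => _ _ _ /allP mub.
by have [/(mem_nth 0)/mub//|/(nth_default 0)->] := ltnP i (size mu).
Qed.

Lemma young_nth_anti i j : i <= j -> nth 0 mu j <= nth 0 mu i.
Proof.
move=> ij; case/and4P: yng => mus _ _ _.
have [jlt|/(nth_default 0)->//] := ltnP j (size mu).
by apply: (sorted_leq_nth geq_transitive leqnn 0 mus) => //; rewrite inE; lia.
Qed.

Let lam := add_hook a b.+1 mu.

Lemma part_add_hook i : 0 < i <= a -> part lam i.+1 = (part mu i).+1.
Proof. by case: i => // i /= ia; rewrite /part /= nth_mkseq. Qed.

(** The first row reaches column [i.+1] since [i <= b]; the rows added beyond [mu] have length one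
    and do not, since [0 < i]. *)
Lemma conjp_add_hook i : 0 < i <= b -> conjp lam i.+1 = (conjp mu i).+1.
Proof.
case/andP=> i0 ib; rewrite /conjp /= ltnS ib add1n; congr _.+1.
rewrite /mkseq count_map -(subnKC mu_size) iotaD count_cat.
rewrite [X in _ + X](_ : _ = 0) ?addn0; last first.
  apply/eqP; rewrite -leqn0 leqNgt -has_count; apply/hasPn => j /=.
  by rewrite mem_iota add0n => /andP[jmu _]; rewrite nth_default // ltnS -ltnNge.
rewrite -[in RHS](mkseq_nth 0 mu) /mkseq count_map.
exact: eq_count.
Qed.

Lemma durfee_add_hook : durfee lam = (durfee mu).+1.
Proof.
apply/eqP; rewrite eqn_leq; apply/andP; split; last first.
  apply: durfee_max; have := durfee_part mu; have := durfee_size mu.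
  by case: (durfee mu) => // d dmu dp; rewrite part_add_hook //; lia.
have := durfee_part lam; have := durfee_size lam.
rewrite /lam /add_hook /= size_mkseq -/(add_hook a b.+1 mu) -/lam.
case: (durfee lam) => // -[//|d] da.
by rewrite part_add_hook ?ltnS; [apply: durfee_max | lia].
Qed.

(** The outer hook has [a.+1] rows and [b.+1] columns sharing a corner. For an inner hook, [part]
    and [conjp] both grow by one and the index moves by one, so its size is unchanged. *)
Lemma hd_add_hook : hd lam = (a + b).+1 :: hd mu.
Proof.
rewrite /hd durfee_add_hook [iota _ _]/= map_cons; congr (_ :: _).
  rewrite /part /conjp /= add1n count_map (eq_count (a2 := predT)) // count_predT size_iota.
  by lia.
rewrite (iotaDl 1 1) -map_comp; apply/eq_in_map => i.
rewrite mem_iota add1n ltnS => /andP[i0 id]; rewrite /comp add1n.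
have da := durfee_size mu.
have db : durfee mu <= b by apply: leq_trans (durfee_part mu) (mu_le _).
rewrite part_add_hook ?conjp_add_hook ?i0 ?(leq_trans id) //; last exact: leq_trans mu_size.
by rewrite doubleS; move: (part mu i) (conjp mu i) i.*2 => x y z; lia.
Qed.

Lemma is_young_add_hook : is_young a.+1 b.+1 lam.
Proof.
apply/and4P; split; rewrite /lam /add_hook /= ?size_mkseq //.
- rewrite path_sortedE; last exact: geq_transitive.
  apply/andP; split.
    by apply/allP => x /mapP[i _ ->] /=; rewrite ltnS mu_le.
  apply/(sortedP 0) => i; rewrite size_mkseq => ia.
  by rewrite !nth_mkseq ?(ltnW ia) //= ltnS young_nth_anti.
- by apply/allP => x /mapP[i _ ->].
- by rewrite ltnSn; apply/allP => x /mapP[i _ ->] /=; rewrite ltnS mu_le.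
Qed.

End AddHook.

(** * Words with given letter counts and diagrams in a box *)

Lemma young_word_ind (P : seq bool -> Prop) :
  P [::] ->
  (forall r, P r -> P (true :: r)) ->
  (forall r, P r -> head false r = false -> P (false :: r)) ->
  (forall r, P r -> P [:: false, true & r]) -> forall r, P r.
Proof.
move=> P0 PU PD PDU r; have [n] := ubnP (size r).
elim: n r => // n IH [//|[] r] /= rn; first by apply: PU; apply: IH; lia.
case: r rn => [|[] r] /= rn; first exact: PD.
  by apply: PDU; apply: IH; lia.
by apply: PD => //; apply: IH => /=; lia.
Qed.

Lemma young_of_wordD r : head false r = false ->
  young_of_word (false :: r) = young_of_word r.
Proof. by case: r => [|[]]. Qed.

Lemma is_youngW a b c d lam :
  a <= c -> b <= d -> is_young a b lam -> is_young c d lam.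
Proof.
move=> ac bd /and4P[h1 h2 h3 h4]; apply/and4P; split=> //; first exact: leq_trans ac.
by apply: sub_all h4 => x /leq_trans; apply.
Qed.

Lemma young_of_word_young r :
  is_young (count negb r) (count id r) (young_of_word r).
Proof.
elim/young_word_ind: r => //.
- by move=> r; rewrite /= add0n add1n; apply: is_youngW.
- by move=> r yr /young_of_wordD->; apply: is_youngW yr => /=; lia.
- by move=> r yr; rewrite /= !add0n !add1n is_young_add_hook.
Qed.

(** If the word does not end in U, every U precedes its last factor UD and so gives a column of the
    outermost hook. *)
Lemma head_young_of_word r : head false r = false ->
  head 0 (young_of_word r) = count id r.
Proof.
elim/young_word_ind: r => //.
by move=> r IH hr _; rewrite young_of_wordD //= add0n IH.
Qed.

(** For fixed letter counts the diagram reveals the end of a nonempty word: it is U exactly when the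
    first row is not full, and otherwise UD exactly when all rows of the box are occupied. *)
Lemma young_of_word_inj r s : count negb r = count negb s ->
  count id r = count id s -> young_of_word r = young_of_word s -> r = s.
Proof.
have young_head a b lam : is_young a b lam -> head 0 lam <= b.
  by case/and4P=> _ _ _; case: lam => //= x lam /andP[].
have sz a b lam : is_young a b lam -> size lam <= a by case/and4P.
have UD r1 s1 : count id (true :: r1) = count id (false :: s1) ->
    young_of_word (true :: r1) = young_of_word (false :: s1) -> False.
  move=> eU eY; have := young_head _ _ _ (young_of_word_young r1).
  have := head_young_of_word (erefl : head false (false :: s1) = false).
  by rewrite -eY -eU /= => ->; lia.
have DD r1 s1 : count negb [:: false, true & r1] = count negb (false :: s1) ->
    head false s1 = false ->
    young_of_word [:: false, true & r1] = young_of_word (false :: s1) -> False.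
  move=> eD hs; rewrite (young_of_wordD hs) => eY.
  have := sz _ _ _ (young_of_word_young s1).
  by rewrite -eY /= size_mkseq; move: eD => /=; lia.
elim/young_word_ind: r s.
- by case=> //= -[] s /=; lia.
- move=> r IH [|[] s] eD eU eY; [by move: eU => /=; lia | | by case: (UD r s)].
  by congr (_ :: _); apply: IH => //; move: eD eU => /=; lia.
- move=> r IH hr [|[] s] eD eU eY; [by move: eD => /=; lia | by case: (UD s r) | ].
  have [hs|hs] := eqVneq (head false s) false.
    rewrite !young_of_wordD // in eY.
    by congr (_ :: _); apply: IH => //; move: eD eU => /=; lia.
  by case: s hs eD eU eY => [|[] s] // _ eD eU eY; case: (DD s r).
- move=> r IH [|[] s] eD eU eY; [by move: eU => /=; lia | by case: (UD s (true :: r)) | ].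
  have [hs|hs] := eqVneq (head false s) false; first by case: (DD r s).
  case: s hs eD eU eY => [|[] s] // _ eD eU [_ eY].
  have eD' : count negb r = count negb s by move: eD => /=; lia.
  have eU' : count id r = count id s by move: eU => /=; lia.
  do 2!congr (_ :: _); apply: IH => //.
  have /and4P[_ pr szr _] := young_of_word_young r.
  have /and4P[_ ps szs _] := young_of_word_young s.
  have nth_eq i : nth 0 (young_of_word r) i = nth 0 (young_of_word s) i.
    have [ilt|ige] := ltnP i (count negb r); last first.
      by rewrite !nth_default //; lia.
    have := congr1 (fun t => nth 0 t i) eY.
    by rewrite -eD' !nth_mkseq // => -[].
  apply: (eq_from_nth (x0 := 0)) => [|i _]; last exact: nth_eq.
  (* All rows are positive, so reading them with default 0 determines the number of rows. *)
  have le t u : all (ltn 0) u -> (forall i, nth 0 t i = nth 0 u i) -> size u <= size t.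
    move=> pu tu; rewrite leqNgt; apply/negP => lt.
    by have := allP pu _ (mem_nth 0 lt); rewrite /= -tu nth_default.
  by apply/eqP; rewrite eqn_leq !le.
Qed.

Lemma young_add_hook a b lam : is_young a.+1 b.+1 lam -> size lam = a.+1 ->
  head 0 lam = b.+1 -> exists2 mu, is_young a b mu & lam = add_hook a b.+1 mu.
Proof.
case: lam => // x lam yl [sl] /= ex; rewrite {x}ex in yl *.
have nth_lam i : nth 0 lam i <= b.+1 by exact: (young_nth_anti yl (leq0n i.+1)).
have lam_gt0 i : i < a -> 0 < nth 0 lam i.
  by case/and4P: yl => _ /=/allP lp _ _ ia; apply: lp; rewrite mem_nth ?sl.
(* Removing the first column empties the rows of length one, which must be dropped. *)
exists [seq x <- [seq y.-1 | y <- lam] | 0 < x].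
  apply/and4P; split.
  - apply: sorted_filter; first exact: geq_transitive.
    apply/(sortedP 0) => i; rewrite size_map => il.
    rewrite !(nth_map 0) //; last exact: ltnW.
    have := young_nth_anti yl (leqnSn i.+1) => /= ?.
    by rewrite /geq /=; lia.
  - exact: filter_all.
  - by rewrite size_filter (leq_trans (count_size _ _)) // size_map sl.
  - apply/allP => x; rewrite mem_filter => /andP[_ /mapP[y /(nthP 0)[i _ <-] ->]].
    by have := nth_lam i; move=> /=; lia.
congr (_ :: _); apply: (eq_from_nth (x0 := 0)); rewrite ?size_mkseq ?sl // => i ia.
rewrite nth_mkseq //.
have sm : sorted geq [seq y.-1 | y <- lam].
  apply/(sortedP 0) => j; rewrite size_map => jl.
  rewrite !(nth_map 0) //; last exact: ltnW.
  by have := young_nth_anti yl (leqnSn j.+1) => /= ?; rewrite /geq /=; lia.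
(* In a weakly decreasing list the zeros form a tail, so dropping them is invisible to [nth] with
   default 0. *)
have nth_filter t : sorted geq t -> forall k, nth 0 [seq x <- t | 0 < x] k = nth 0 t k.
  elim: t => //= y t IH yt k; case: ltnP => y0; first by case: k => //= k; rewrite IH ?(path_sorted yt).
  have t0 : all (geq y) t by move: yt; rewrite (path_sortedE geq_transitive) => /andP[].
  have z j : nth 0 t j = 0.
    have [jl|/(nth_default 0)//] := ltnP j (size t).
    by have := allP t0 _ (mem_nth 0 jl) => /=; lia.
  rewrite IH ?(path_sorted yt) // z; case: k => //= ; lia.
rewrite nth_filter // (nth_map 0) ?sl //.
by have := lam_gt0 i ia; lia.
Qed.

(** Induction on [a + b]: the word ends in U if the first row is not full, in D if the last row of
    the box is empty, and otherwise in UD, with the outermost hook removed. *)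
Lemma young_of_word_surj a b lam : is_young a b lam ->
  exists r, [/\ count negb r = a, count id r = b & young_of_word r = lam].
Proof.
have [n] := ubnP (a + b); elim: n a b lam => // n IH a b lam nab yl.
case: b yl nab => [|b] yl nab.
  exists (nseq a false); rewrite !count_nseq /= mul1n mul0n; split=> //.
  case/and4P: yl => _; case: lam => [|x lam] /=; last by case: x.
  by move=> _ _ _; elim: (a) => // -[|k].
have [lt|ge] := leqP (head 0 lam) b.
  have /IH [|r [rD rU rY]] : is_young a b lam.
  - case/and4P: (yl) => h1 h2 h3 h4; apply/and4P; split => //.
    apply/allP => x /(nthP 0)[i _ <-]; apply: leq_trans lt.
    by rewrite -nth0; apply: (young_nth_anti yl).
  - by lia.
  by exists (true :: r); rewrite /= rD rU rY.
have hl : head 0 lam = b.+1.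
  apply/eqP; rewrite eqn_leq ge andbT; case/and4P: yl => _ _ _.
  by case: (lam) => //= x l /andP[].
case: a yl nab => [|a] yl nab.
  by case/and4P: yl => _ _; case: lam hl ge.
have [sl|sl] := ltnP (size lam) a.+1.
  have /IH [|r [rD rU rY]] : is_young a b.+1 lam.
  - by case/and4P: (yl) => h1 h2 h3 h4; apply/and4P.
  - by lia.
  exists (false :: r); split; [by rewrite /= rD| by rewrite /= rU|].
  (* [r] cannot begin with U: its diagram would fit in [b] columns, but the first row has length
     [b.+1]. *)
  rewrite young_of_wordD //; case: r rD rU rY => [|[] r] //= _ rU rY.
  have /and4P[_ _ _] := young_of_word_young r.
  by rewrite rY; case: (lam) hl => //= x l -> /andP[]; lia.
have [|mu ymu ->] := young_add_hook yl _ hl.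
  by case/and4P: yl; lia.
have [|r [rD rU rY]] := IH _ _ _ _ ymu; first by lia.
by exists [:: false, true & r]; rewrite /= rD rU rY; split => //; lia.
Qed.

(** * Hook sizes are the positions of the factors UD *)

Definition peak (w : seq bool) i := nth false w i && ~~ nth true w i.+1.

(** The default [true] in [peak] keeps a final U from being a peak until a D is appended. *)
Lemma peak_rcons w x i :
  peak (rcons w x) i = peak w i || [&& i.+1 == size w, nth false w i & ~~ x].
Proof.
rewrite /peak !nth_rcons; case: (ltngtP i.+1 (size w)) => [lt|gt|e].
- by rewrite orbF.
- by rewrite orbF andbF [nth true w _]nth_default ?andbF // ltnW.
- by rewrite [nth true w _]nth_default ?e ?andbF.
Qed.

Lemma hd_nil : hd [::] = [::].
Proof.
by rewrite /hd (_ : durfee _ = 0) //; apply/eqP; rewrite -leqn0 durfee_size.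
Qed.

Lemma hd_young_of_word0 r : (0 \in hd (young_of_word r)) = false.
Proof.
elim/young_word_ind: r => [|//|r IH hr|r IH]; first by rewrite hd_nil.
  by rewrite young_of_wordD.
by rewrite /= hd_add_hook ?young_of_word_young // inE IH.
Qed.

Lemma hd_young_of_word r i :
  (i.+1 \in hd (young_of_word r)) = peak (rev r) i.
Proof.
elim/young_word_ind: r.
- by rewrite hd_nil /peak !nth_nil.
- by move=> r IH; rewrite rev_cons peak_rcons !andbF orbF.
- move=> r IH hr; rewrite young_of_wordD // IH rev_cons peak_rcons andbT.
  case: eqP => [si|]; last by rewrite orbF.
  rewrite size_rev in si; rewrite nth_rev -si // subnn nth0.
  by rewrite hr orbF.
- move=> r IH; rewrite /= hd_add_hook ?young_of_word_young // inE IH.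
  (* The new hook has size [(size r).+1], which is the 1-based position of the appended U. *)
  have -> : count negb r + count id r = size r by rewrite addnC count_predC.
  rewrite !rev_cons !peak_rcons !andbF orbF !andbT size_rcons size_rev !eqSS orbC.
  by case: eqP => // ->; rewrite nth_rcons size_rev ltnn eqxx.
Qed.

(** * Replacing fixed points by U or D, and recovering them *)

(* Letters of a 321-avoiding involution: [Some true] and [Some false] are the
   smaller and the larger element of a 2-cycle, [None] is a fixed point; [h] is
   the number of 2-cycles already open. *)
Fixpoint matched (h : nat) (v : seq (option bool)) : bool :=
  match v with
  | [::] => h == 0
  | Some true :: v' => matched h.+1 v'
  | Some false :: v' => (0 < h) && matched h.-1 v'
  | None :: v' => (h == 0) && matched 0 v'
  end.

Fixpoint fill (j : nat) (v : seq (option bool)) : seq bool :=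
  match v with
  | [::] => [::]
  | Some x :: v' => x :: fill j v'
  | None :: v' => (j == 0) :: fill j.-1 v'
  end.

(* [w], started at height [h], reaches height -1. *)
Fixpoint descends (h : nat) (w : seq bool) : bool :=
  match w, h with
  | [::], _ => false
  | true :: w', _ => descends h.+1 w'
  | false :: w', h'.+1 => descends h' w'
  | false :: w', 0 => true
  end.

(* At height 0 a U is matched iff the path returns to its starting height. *)
Fixpoint unfill (h : nat) (w : seq bool) : seq (option bool) :=
  match w, h with
  | [::], _ => [::]
  | false :: w', h'.+1 => Some false :: unfill h' w'
  | false :: w', 0 => None :: unfill 0 w'
  | true :: w', h'.+1 => Some true :: unfill h.+1 w'
  | true :: w', 0 => if descends 0 w' then Some true :: unfill 1 w' else None :: unfill 0 w'
  end.

(** Fixed points occur only at height 0, hence after the path has closed the [h.+1] open cycles; the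
    letters put there come too late to matter. *)
Lemma descends_fill h j v : matched h.+1 v -> descends h (fill j v).
Proof. by elim: v h => //= -[[]|] v IH [|h] //=; apply: IH. Qed.

Lemma descends_fill0 h v : matched h v -> descends h (fill 0 v) = false.
Proof.
elim: v h => //= -[[]|] v IH [|h] //=; try exact: IH.
move=> /IH; move: (fill 0 v) => w.
(* A fixed point turned into U raises the rest of the path by one, which makes -1 only harder to
   reach. *)
have: forall h, descends h w = false -> descends h.+1 w = false.
  by elim: w {IH} => //= -[] w IH [|k] //; apply: IH.
by move=> H /H.
Qed.

(** A U opening a 2-cycle is recognised by the return of the path. A fixed point filled with D is a
    D at height 0; one filled with U has only U-filled fixed points after it, so the path does not
    return. *)
Lemma fillK h j v : matched h v -> unfill h (fill j v) = v.
Proof.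
elim: v h j => //= -[[]|] v IH h j.
- by case: h => [|h] mv; rewrite /= ?descends_fill // IH.
- by case/andP; case: h => //= h _ mv; rewrite IH.
- case/andP => /eqP-> mv; case: j => [|j] /=; last by rewrite IH.
  by rewrite descends_fill0 // IH.
Qed.


Lemma size_fill j v : size (fill j v) = size v.
Proof. by elim: v j => //= -[x|] v IH j /=; rewrite IH. Qed.

Lemma count_fill j v : count negb (fill j v) =
  count_mem (Some false) v + minn j (count_mem None v).
Proof. by elim: v j => [|[[]|] v IH] j //=; rewrite IH; case: j => //=; lia. Qed.

Lemma matched_count h v : matched h v ->
  h + count_mem (Some true) v = count_mem (Some false) v.
Proof.
elim: v h => [h /eqP->//|[[]|] v IH] h //=.
- by move/IH => <-; rewrite add0n add1n addSnnS.
- by case/andP => h0 /IH <-; rewrite add0n addnA add1n prednK.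
- by case/andP => /eqP-> /IH <-.
Qed.

Lemma size_count3 (v : seq (option bool)) :
  size v = count_mem (Some true) v + count_mem (Some false) v + count_mem None v.
Proof. by elim: v => //= -[[]|] v -> /=; lia. Qed.

Definition open_close (v : seq (option bool)) i :=
  (nth None v i == Some true) && (nth None v i.+1 == Some false).

(** A fixed point, being at height 0, neither follows an opener nor precedes a closer, and the fixed
    points filled with D come before those filled with U; so filling creates no UD. *)
Lemma peak_fill h j v i : matched h v -> peak (fill j v) i = open_close v i.
Proof.
rewrite /peak /open_close.
elim: v h j i => [|x v IH] h j [|i] //=.
- case: x => [[]|] //=.
  + by case: v {IH} => //= -[[]|] v.
  + by case/andP=> _; case: j => //=; case: v {IH} => //= -[[]|].
- by case: x => [[]|] /=; [|case/andP=> _|case/andP=> _]; exact: IH.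
Qed.

(** The hypothesis says that the [h] open cycles get closed: reaching -1 from [h.-1] is reaching 0
    from [h]. *)
Lemma unfill_matched h w : ((h == 0) || descends h.-1 w) -> matched h (unfill h w).
Proof.
elim: w h => [[]//|[] w IH] [|h] //=.
- by case: ifP => /= dw _; apply: IH => //=; rewrite dw.
- by move=> dw; apply: IH.
- by move=> _; apply: IH.
- by move=> dw; apply: IH; case: h dw.
Qed.

Lemma unfill0K h w : (h == 0) || descends h.-1 w -> descends h w = false ->
  fill 0 (unfill h w) = w.
Proof.
elim: w h => [[]//|[] w IH] [|h] //=.
- by case: ifP => dw _ dw1 /=; rewrite IH //= dw.
- by move=> dw dw1; rewrite IH.
- by move=> dw dw1; rewrite IH //; case: h dw {dw1}.
Qed.

Lemma unfillK h w : (h == 0) || descends h.-1 w ->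
  exists2 j, j <= count_mem None (unfill h w) & fill j (unfill h w) = w.
Proof.
elim: w h => [|[] w IH] [|h] //=; try by exists 0.
- case: ifP => dw _.
    by have [|j jle jK] := IH 1; [|exists j; rewrite /= ?jK].
  (* After an unmatched U the path never falls below its height, so no later unmatched letter is a
     D. *)
  by exists 0; rewrite //= unfill0K.
- by move=> dw; have [//|j jle jK] := IH h.+2; exists j; rewrite /= ?jK.
- by move=> _; have [//|j jle jK] := IH 0; exists j.+1; rewrite //= jK.
- move=> dw; have [|j jle jK] := IH h; first by case: h dw.
  by exists j; rewrite /= ?jK.
Qed.

(** * Matching expressed by prefix counts *)

Definition before (x : option bool) (v : seq (option bool)) (k : nat) : nat :=
  count_mem x (take k v).

Lemma beforeS x v k : before x v k.+1 = before x v k + ((k < size v) && (nth None v k == x)).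
Proof.
rewrite /before; have [lt|ge] := ltnP k (size v).
  by rewrite (take_nth None lt) -cats1 count_cat /= addn0.
by rewrite !take_oversize ?addn0 // ltnW.
Qed.

Lemma before_mono x v i j : i <= j -> before x v i <= before x v j.
Proof.
move/subnKC <-; elim: (j - i) => [|d IH]; first by rewrite addn0.
by rewrite addnS beforeS (leq_trans IH) ?leq_addr.
Qed.

Lemma before_lt x v i j : i < size v -> nth None v i = x -> i < j ->
  before x v i < before x v j.
Proof.
move=> iv ix /(before_mono x v); apply: leq_trans.
by rewrite beforeS iv ix eqxx addn1.
Qed.

Lemma before_surj x v n k : k < before x v n ->
  exists2 i, i < size v & nth None v i = x /\ before x v i = k.
Proof.
elim: n => [|n IH]; first by rewrite /before take0.
rewrite beforeS; case: (ltnP n (size v)) => [nv|_] /=; last by rewrite addn0.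
case: eqP => [nx|_] /=; last by rewrite addn0.
rewrite addn1 ltnS leq_eqVlt => /predU1P[->|//]; by exists n.
Qed.

Lemma before_inj x v i j : i < size v -> j < size v -> nth None v i = x ->
  nth None v j = x -> before x v i = before x v j -> i = j.
Proof.
move=> iv jv ix jx e; case: (ltngtP i j) => // lt.
- by have := before_lt iv ix lt; rewrite e ltnn.
- by have := before_lt jv jx lt; rewrite e ltnn.
Qed.

(** The height before position [k] is [h] plus the openers minus the closers read so far: it stays
    nonnegative and vanishes at fixed points and at the end. *)
Lemma matchedP h v :
  reflect [/\ forall k, before (Some false) v k <= h + before (Some true) v k,
    forall k, k < size v -> nth None v k = None ->
      before (Some false) v k = h + before (Some true) v k &
    before (Some false) v (size v) = h + before (Some true) v (size v)]
  (matched h v).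
Proof.
have b0 x v' : before x v' 0 = 0 by rewrite /before take0.
have bS x y v' k : before x (y :: v') k.+1 = (y == x) + before x v' k by [].
elim: v h => [|y v IH] h.
  apply: (iffP eqP) => [->|[_ _]]; last by rewrite /before /= addn0.
  by split=> // k; rewrite /before.
case: y => [[]|] /=.
- apply: (iffP (IH _)) => -[h1 h2 h3]; split.
  + by case=> [|k]; rewrite ?b0 // !bS addnA addn1; exact: h1.
  + by case=> [|k] //=; rewrite ltnS !bS addnA addn1; exact: h2.
  + by rewrite !bS addnA addn1.
  + by move=> k; have := h1 k.+1; rewrite !bS addnA addn1.
  + by move=> k; have := h2 k.+1; rewrite !bS addnA addn1.
  + by rewrite !bS addnA addn1 in h3.
- apply: (iffP andP) => [[h0 /IH[h1 h2 h3]]|[h1 h2 h3]].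
    case: h h0 h1 h2 h3 => // h _ h1 h2 h3; split.
    + by case=> [|k]; rewrite ?b0 // !bS addSn ltnS; exact: h1.
    + by case=> [|k] //=; rewrite ltnS !bS addSn => kv kN; congr _.+1; exact: h2.
    + by rewrite !bS addSn; congr _.+1.
  have h0 : 0 < h by have := h1 1; rewrite !bS !b0; rewrite !addn0.
  split=> //; case: h h0 h1 h2 h3 => // h _ h1 h2 h3; apply/IH; split.
  + by move=> k; have := h1 k.+1; rewrite !bS.
  + by move=> k kv kN; have := h2 k.+1 kv kN; rewrite !bS => -[].
  + by move: h3; rewrite !bS => -[].
- apply: (iffP andP) => [[/eqP-> /IH[h1 h2 h3]]|[h1 h2 h3]].
    by split=> // -[|k]; rewrite ?b0 //; [exact: h1 | exact: h2].
  have h0 : h = 0 by have := h2 0 isT erefl; rewrite !b0; lia.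
  rewrite {}h0 in h1 h2 h3 *; split=> //; apply/IH; split=> //.
  + by move=> k; exact: (h1 k.+1).
  + by move=> k; exact: (h2 k.+1).
Qed.

(** * From 321-avoiding involutions to matched words *)

Section Letters.
Variable n : nat.
Implicit Types (p q : 'S_n) (i j z : 'I_n).

Definition letter p (i : 'I_n) : option bool :=
  if p i == i then None else Some (i < p i).

Definition letters p := [seq letter p i | i <- enum 'I_n].

Lemma size_letters p : size (letters p) = n.
Proof. by rewrite size_map size_enum_ord. Qed.

Lemma nth_letters p (i : 'I_n) : nth None (letters p) i = letter p i.
Proof. by rewrite (nth_map i) ?size_enum_ord // nth_ord_enum. Qed.

Lemma letterT p i : (letter p i == Some true) = (i < p i).
Proof. by rewrite /letter; case: (p i =P i) => [e|_]; [rewrite e ltnn | case: (i < p i)]. Qed.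

Lemma letterF p i : (letter p i == Some false) = (p i < i).
Proof.
rewrite /letter; case: (p i =P i) => [e|ne]; first by rewrite e ltnn.
rewrite [RHS]ltn_neqAle [p i <= i]leqNgt (_ : _ != _); last by apply/eqP => /val_inj.
by case: (i < p i).
Qed.

Lemma letterN p i : (letter p i == None) = (p i == i).
Proof. by rewrite /letter; case: (p i =P i). Qed.

Lemma card_count (A : pred 'I_n) : #|A| = count A (enum 'I_n).
Proof. by rewrite cardE enumT -size_filter. Qed.

Lemma before_letters x p k :
  before x (letters p) k = #|[set i : 'I_n | (letter p i == x) && (i < k)]|.
Proof.
rewrite /before /letters -map_take count_map cardsE card_count.
have [kn|nk] := leqP k n; last first.
  rewrite take_oversize ?size_enum_ord; last exact: ltnW.
  apply: eq_count => i /=.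
  by rewrite (ltn_trans (ltn_ord i) nk) andbT.
rewrite -[in RHS](cat_take_drop k (enum 'I_n)) count_cat.
rewrite [X in _ + X](_ : _ = 0) ?addn0; last first.
  apply/eqP; rewrite -leqn0 leqNgt -has_count; apply/hasPn => i /(nthP i)[j].
  rewrite size_drop size_enum_ord => jn; rewrite nth_drop => <-.
  rewrite /= nth_enum_ord ?negb_and; last by lia.
  by rewrite -leqNgt leq_addr orbT.
apply/eq_in_count => i /(nthP i)[j]; rewrite size_take size_enum_ord => jn.
have jk : j < k by move: jn; case: ifP => //; lia.
rewrite nth_take // => <-; rewrite [RHS]/= nth_enum_ord ?jk ?andbT //; lia.
Qed.

Lemma count_None_letters p : count_mem None (letters p) = fp p.
Proof.
rewrite /letters count_map /fp cardsE card_count.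
by apply: eq_count => i; rewrite /= letterN.
Qed.

Section Involution.
Variable p : 'S_n.
Hypothesis pI : inv321 p.

Let pK i : p (p i) = i.
Proof. by case/andP: pI => /forallP/(_ i)/eqP. Qed.

Let p321 (i j k : 'I_n) : i < j -> j < k -> p k < p j -> p j < p i -> False.
Proof.
move=> ij jk kj ji; case/andP: pI => _ /forallP/(_ i)/forallP/(_ j)/forallP/(_ k).
by rewrite ij jk kj ji.
Qed.

(** For nested 2-cycles, the positions [i], [j], [p j] would carry a 321. *)
Lemma exc_mono i j : i < p i -> j < p j -> i < j -> p i < p j.
Proof.
move=> ii jj ij; rewrite ltnNge leq_eqVlt; apply/negP => /predU1P[/val_inj/perm_inj ji|ji].
  by rewrite ji ltnn in ij.
by apply: (p321 ij jj); rewrite ?pK.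
Qed.

Lemma def_mono i j : p i < i -> p j < j -> i < j -> p i < p j.
Proof.
move=> ii jj ij; rewrite ltnNge leq_eqVlt; apply/negP => /predU1P[/val_inj/perm_inj ji|ji].
  by rewrite ji ltnn in ij.
have := @exc_mono (p j) (p i); rewrite !pK => /(_ jj ii ji).
by rewrite ltnNge ltnW.
Qed.

(** Otherwise the positions [i], [z], [p i] would carry a 321. *)
Lemma fixed_uncovered i z : p z = z -> i < z -> p i < z.
Proof.
move=> pz iz; rewrite ltnNge leq_eqVlt; apply/negP => /predU1P[|zi].
  by rewrite -{1}pz => /val_inj/perm_inj zi; rewrite zi ltnn in iz.
by apply: (p321 iz zi); rewrite ?pK ?pz.
Qed.

Let card_le (A B : {set 'I_n}) : (forall i, i \in A -> p i \in B) -> #|A| <= #|B|.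
Proof.
move=> AB; rewrite -(card_imset _ (@perm_inj _ p)); apply: subset_leq_card.
by apply/subsetP => _ /imsetP[i iA ->]; apply: AB.
Qed.

Lemma matched_letters : matched 0 (letters p).
Proof.
have FT k : before (Some false) (letters p) k <= before (Some true) (letters p) k.
  rewrite !before_letters; apply: card_le => i; rewrite !inE letterF letterT pK.
  by case/andP=> pii ik; rewrite pii (ltn_trans pii).
(* Equality holds when no 2-cycle straddles [k], which is the case at a fixed point and at the
   end. *)
have TF k : (forall i, i < p i -> i < k -> p i < k) ->
    before (Some true) (letters p) k <= before (Some false) (letters p) k.
  move=> H; rewrite !before_letters; apply: card_le => i; rewrite !inE letterF letterT pK.
  by case/andP=> ipi ik; rewrite ipi H.
apply/matchedP; split=> [|k|]; rewrite ?size_letters //.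
- move=> kn; rewrite (nth_letters p (Ordinal kn)) => /eqP; rewrite letterN => /eqP pk.
  apply/eqP; rewrite eqn_leq FT TF // => i _; exact: (fixed_uncovered pk).
- by apply/eqP; rewrite eqn_leq FT TF.
Qed.

(** By monotonicity [p] exchanges the closers before [p i] with the openers before [i], so partners
    have equal rank. *)
Lemma before_partner i : i < p i ->
  before (Some false) (letters p) (p i) = before (Some true) (letters p) i.
Proof.
move=> ipi; apply/eqP; rewrite eqn_leq !before_letters.
apply/andP; split; apply: card_le => c; rewrite !inE letterF letterT pK => /andP[cc ci]; rewrite cc /=.
  by have := def_mono cc _ ci; rewrite pK; apply.
exact: exc_mono.
Qed.

(** If [i] were not an opener, [j] would be a closer, against [fixed_uncovered] or [def_mono]; given
    an opener at [i], the same argument makes [j] a closer. *)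
Lemma descent_letters (i j : 'I_n) : j = i.+1 :> nat ->
  (p j < p i) = (i < p i) && (p j < j).
Proof.
move=> ji; apply/idP/andP => [pji|[ipi]]; last by rewrite ji ltnS => /leq_ltn_trans; apply.
have ij : i < j by rewrite ji.
have ipi : i < p i.
  rewrite ltnNge; apply/negP => pii.
  have pjj : p j < j by apply: ltn_trans ij; apply: leq_trans pji pii.
  move: pii; rewrite leq_eqVlt => /predU1P[/val_inj pii|pii].
    have := @fixed_uncovered (p j) i pii; rewrite -{1}pii => /(_ pji).
    by rewrite pK ltnNge ltnW.
  by have := def_mono pii pjj ij; rewrite ltnNge ltnW.
split=> //; rewrite ltn_neqAle [p j <= j]leqNgt; apply/andP; split.
  apply/eqP => /val_inj pjj; have := fixed_uncovered pjj ij.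
  by rewrite ji ltnS leqNgt ipi.
by apply/negP => jpj; have := exc_mono ipi jpj ij; rewrite ltnNge ltnW.
Qed.

Lemma mem_Des (k : nat) : (k.+1 \in Des p) = open_close (letters p) k.
Proof.
apply/mapP/andP => [[i]|[kO kC]].
  rewrite mem_filter => /andP[/existsP[j /andP[/eqP ji pji]] _] [->].
  rewrite -ji !nth_letters letterT letterF; apply/andP.
  by rewrite -descent_letters.
have kn : k.+1 < n.
  by rewrite -(size_letters p) ltnNge; apply/negP => /(nth_default None) e; rewrite e in kC.
exists (Ordinal (ltnW kn)) => //; rewrite mem_filter mem_enum andbT.
apply/existsP; exists (Ordinal kn); rewrite eqxx /= descent_letters //.
by rewrite -letterT -letterF -!nth_letters kO kC.
Qed.

End Involution.

(** The partner of an opener is the closer of the same rank, which the word determines; closers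
    follow by involutivity. *)
Lemma letters_inj p q : inv321 p -> inv321 q -> letters p = letters q -> p = q.
Proof.
move=> pI qI pq.
have pq_letter i : letter p i = letter q i by rewrite -!nth_letters pq.
have exc_eq i : i < p i -> p i = q i.
  move=> ipi; have iqi : i < q i by rewrite -letterT -pq_letter letterT.
  have pK : p (p i) = i by case/andP: pI => /forallP/(_ i)/eqP.
  have qK : q (q i) = i by case/andP: qI => /forallP/(_ i)/eqP.
  apply/ord_inj/(@before_inj (Some false) (letters p)); rewrite ?size_letters //.
  - by rewrite nth_letters; apply/eqP; rewrite letterF pK.
  - by rewrite pq nth_letters; apply/eqP; rewrite letterF qK.
  - by rewrite (before_partner pI) // pq (before_partner qI).
apply/permP => i; case: (ltngtP i (p i)) => [/exc_eq//|pii|/val_inj pii].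
  have pK : p (p i) = i by case/andP: pI => /forallP/(_ i)/eqP.
  have qK : q (q (p i)) = p i by case/andP: qI => /forallP/(_ (p i))/eqP.
  by rewrite -[in RHS]pK (exc_eq (p i)) ?pK.
by rewrite -pii; apply/esym/eqP; rewrite -letterN -pq_letter letterN -pii.
Qed.

(** * From matched words to 321-avoiding involutions *)

Section OfLetters.
Variable v : seq (option bool).
Hypotheses (v_size : size v = n) (v_matched : matched 0 v).

(* The k-th opener is matched with the k-th closer. *)
Definition partner (i : 'I_n) : 'I_n :=
  if nth None v i is Some c then
    odflt i [pick j : 'I_n | (nth None v j == Some (~~ c)) &&
                     (before (Some (~~ c)) v j == before (Some c) v i)]
  else i.

Let before_total c : before (Some c) v n = before (Some (~~ c)) v n.
Proof. by have [_ _] := matchedP _ _ v_matched; rewrite v_size; case: c. Qed.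

Let lt_size (i : 'I_n) : i < size v. Proof. by rewrite v_size. Qed.

Lemma partnerP i c : nth None v i = Some c ->
  nth None v (partner i) = Some (~~ c) /\
  before (Some (~~ c)) v (partner i) = before (Some c) v i.
Proof.
move=> vi; rewrite /partner vi; case: pickP => [j /andP[/eqP ? /eqP ?]//|none].
have := before_lt (lt_size i) vi (ltn_ord i); rewrite before_total.
case/before_surj => j; rewrite v_size => jn [vj bj].
by have := none (Ordinal jn); rewrite /= vj bj !eqxx.
Qed.

Lemma partner_fixed i : nth None v i = None -> partner i = i.
Proof. by rewrite /partner => ->. Qed.

Lemma partnerK : involutive partner.
Proof.
move=> i; case vi: (nth None v i) => [c|]; last by rewrite !partner_fixed.
have [vp bp] := partnerP vi; have [vpp bpp] := partnerP vp.
rewrite negbK in vpp bpp; apply: val_inj.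
by apply: (before_inj _ _ vpp vi); rewrite ?lt_size // bpp.
Qed.

Lemma partner_gt i : nth None v i = Some true -> i < partner i.
Proof.
move=> vi; have [vp bp] := partnerP vi.
rewrite ltnNge leq_eqVlt; apply/negP => /predU1P[e|lt].
  by rewrite e vi in vp.
have [FT _ _] := matchedP _ _ v_matched.
(* If the closer came first, the prefix ending with it would contain more closers than openers. *)
have := leq_trans (FT (partner i).+1) (before_mono (Some true) v lt).
by rewrite -bp beforeS lt_size vp eqxx addn1 ltnn.
Qed.

Lemma partner_lt i : nth None v i = Some false -> partner i < i.
Proof. by move=> vi; have [vp _] := partnerP vi; rewrite -{2}(partnerK i) partner_gt. Qed.

Lemma partner_mono i j c : nth None v i = Some c -> nth None v j = Some c ->
  i < j -> partner i < partner j.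
Proof.
move=> vi vj ij; have [_ bi] := partnerP vi; have [_ bj] := partnerP vj.
have := before_lt (lt_size i) vi ij; rewrite -bi -bj.
by apply: contraLR; rewrite -!leqNgt => /before_mono.
Qed.

(** The height is 0 at [z], so equally many openers and closers precede it and partners, having
    equal rank, lie on the same side. *)
Lemma partner_side i z : nth None v z = None ->
  (i < z -> partner i < z) /\ (z < i -> z < partner i).
Proof.
move=> vz; case vi: (nth None v i) => [c|]; last by rewrite partner_fixed.
have [vp bp] := partnerP vi.
have bz : before (Some c) v z = before (Some (~~ c)) v z.
  have [_ zz _] := matchedP _ _ v_matched.
  by have := zz z (lt_size z) vz; case: (c).
split=> [iz|zi].
  have := before_lt (lt_size i) vi iz; rewrite bz -bp.
  by apply: contraLR; rewrite -!leqNgt => /before_mono.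
have := before_mono (Some c) v (ltnW zi); rewrite bz -bp leqNgt.
apply: contraR; rewrite -leqNgt leq_eqVlt => /predU1P[e|pz].
  by rewrite e vz in vp.
exact: before_lt (lt_size _) vp pz.
Qed.

(** This excludes 321: the middle element would be both a closer and an opener. *)
Lemma partner_inversion i j : i < j -> partner j < partner i ->
  nth None v i = Some true /\ nth None v j = Some false.
Proof.
move=> ij pji; have npij : ~~ (partner i < partner j) by rewrite -leqNgt ltnW.
case vi: (nth None v i) => [c|]; last first.
  rewrite (partner_fixed vi) in npij.
  by have [_ /(_ ij)] := partner_side j vi; rewrite (negPf npij).
case vj: (nth None v j) => [d|]; last first.
  rewrite (partner_fixed vj) in npij.
  by have [/(_ ij)] := partner_side i vj; rewrite (negPf npij).
case: c d vi vj => [] [] vi vj //; try by rewrite (partner_mono vi vj) in npij.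
case/negP: npij; apply: ltn_trans (partner_lt vi) _.
exact: ltn_trans ij (partner_gt vj).
Qed.

Definition perm_of_letters : 'S_n := perm (inv_inj partnerK).

Lemma perm_of_letters_inv321 : inv321 perm_of_letters.
Proof.
apply/andP; split; first by apply/forallP => i; rewrite !permE partnerK.
apply/forallP => i; apply/forallP => j; apply/forallP => k; rewrite !permE.
apply/negP => /and4P[ij jk kj ji].
have [_ vj] := partner_inversion ij ji; have [vj' _] := partner_inversion jk kj.
by rewrite vj in vj'.
Qed.

Lemma letters_perm_of_letters : letters perm_of_letters = v.
Proof.
apply: (eq_from_nth (x0 := None)) => [|i]; rewrite size_letters // => ilt.
rewrite (nth_letters _ (Ordinal ilt)); case vi: (nth None v i) => [[]|]; apply/eqP.
- by rewrite letterT permE partner_gt.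
- by rewrite letterF permE partner_lt.
- by rewrite letterN permE partner_fixed.
Qed.

End OfLetters.
End Letters.

(** * Involutions and words with [a] letters D and [b] letters U *)

Section Word.
Variables a b : nat.
Hypothesis hab : a <= b.
Implicit Types p q : 'S_(a + b).

Definition word_of p : seq bool :=
  fill (a - count_mem (Some false) (letters p)) (letters p).

Lemma count_word_of p : inv321 p -> b - a <= fp p ->
  count negb (word_of p) = a /\ count id (word_of p) = b.
Proof.
move=> pI pfp; have eO := matched_count (matched_letters pI); rewrite add0n in eO.
have := size_count3 (letters p); rewrite size_letters eO count_None_letters => sz.
have eD : count negb (word_of p) = a.
  (* With c 2-cycles, fp = a + b - 2c. Hence c <= a and, as a <= b, at least a - c fixed points are
     available. *)
  by rewrite count_fill count_None_letters; lia.
split=> //; have := count_predC id (word_of p).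
by rewrite size_fill size_letters [count (predC _) _]eD; lia.
Qed.

Lemma word_of_inj p q : inv321 p -> inv321 q -> word_of p = word_of q -> p = q.
Proof.
move=> pI qI /(congr1 (unfill 0)).
by rewrite !fillK ?matched_letters //; apply: letters_inj.
Qed.

Lemma word_of_surj w : count negb w = a -> count id w = b ->
  exists p, [/\ inv321 p, b - a <= fp p & word_of p = w].
Proof.
move=> wD wU; have [//|j jle jK] := @unfillK 0 w.
have vm : matched 0 (unfill 0 w) by exact: unfill_matched.
have vs : size (unfill 0 w) = a + b.
  by rewrite -(size_fill j) jK -(count_predC id) addnC wU [count (predC _) _]wD.
have eO := matched_count vm; rewrite add0n in eO.
have sz := size_count3 (unfill 0 w); rewrite vs eO in sz.
have := count_fill j (unfill 0 w); rewrite jK wD (minn_idPl jle) => eD.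
(* By [eD], [a] is the number c of closers plus [j]: so c <= a, which bounds the fixed points, and
   [word_of] fills with this same [j]. *)
exists (perm_of_letters vs vm); split.
- exact: perm_of_letters_inv321.
- by rewrite -count_None_letters letters_perm_of_letters; lia.
- by rewrite /word_of letters_perm_of_letters {1}eD addKn.
Qed.

End Word.

Theorem mainTheorem12 (a b : nat) (hab : a <= b) :
  exists theta : 'S_(a + b) -> seq nat,
    [/\ (forall p, inv321 p -> b - a <= fp p -> is_young a b (theta p)),
        (forall p q, inv321 p -> b - a <= fp p -> inv321 q -> b - a <= fp q ->
                     theta p = theta q -> p = q),
        (forall lam, is_young a b lam ->
           exists p, [/\ inv321 p, b - a <= fp p & theta p = lam])
      & (forall p, inv321 p -> b - a <= fp p -> Des p =i hd (theta p))].
Proof.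
exists (fun p => young_of_word (rev (word_of p))); split.
- move=> p pI pfp; have [wD wU] := count_word_of hab pI pfp.
  by have := young_of_word_young (rev (word_of p)); rewrite !count_rev wD wU.
- move=> p q pI pfp qI qfp eY.
  have [pD pU] := count_word_of hab pI pfp; have [qD qU] := count_word_of hab qI qfp.
  apply: word_of_inj => //; apply/(can_inj revK)/young_of_word_inj => //.
    by rewrite !count_rev pD.
  by rewrite !count_rev pU.
- move=> lam /young_of_word_surj[r [rD rU <-]].
  have [||p [pI pfp wp]] := @word_of_surj a b hab (rev r); rewrite ?count_rev //.
  by exists p; rewrite wp revK.
- move=> p pI pfp [|k].
    (* Descents are counted from 1, so 0 belongs to neither side. *)
    by rewrite hd_young_of_word0; apply/negP => /mapP[].
  rewrite (mem_Des pI) hd_young_of_word revK /word_of.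
  by rewrite (peak_fill _ _ (matched_letters pI)).
Qed.
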